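(* Let $\pi\colon\mathbb R^n\to U\subset G_k(n)$ be a skew fibration of $\mathbb R^n$ by oriented affine $k$-planes, and let $L=\bigcup_{u\in U}(u\cap S^{n-1})$. For $\ell\in L$ let $\iota(\ell)\in U$ denote the unique $u\in U$ containing $\ell$. Let $\ell\in L$, $u=\iota(\ell)$, and let $y_n\in\mathbb R^n$ be a sequence of points with $|y_n|\to\infty$ and $y_n/|y_n|\to\ell$. Then $\pi(y_n)\to u$ in $G_k(n)$.
   Context: A fibration of $\mathbb R^n$ by oriented affine $k$-planes is a family of pairwise disjoint oriented affine $k$-planes covering $\mathbb R^n$ such that the map sending a point to its fiber is continuous; $\pi(x)\in G_k(n)$ is the oriented linear $k$-plane parallel to the fiber through $x$, and $U=\pi(\mathbb R^n)$. The fibration is skew if no two distinct fibers contain parallel lines (so $\pi$ is injective on fibers and $\iota$ is well defined). $S^{n-1}$ is the unit sphere of $\mathbb R^n$, whose points are viewed as oriented directions. *)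

(* Defs.v *)
From HB Require Import structures.
From mathcomp Require Import all_boot all_order all_algebra.
From mathcomp Require Import all_classical all_reals all_analysis.
Set Implicit Arguments. Unset Strict Implicit. Unset Printing Implicit Defensive.
Import Order.TTheory GRing.Theory Num.Theory.
Import numFieldNormedType.Exports.
Local Open Scope classical_set_scope.
Local Open Scope ring_scope.

Section Defs.
Variable R : realType.

Definition mx_cvg (m n : nat) (A : nat -> 'M[R]_(m, n)) (B : 'M[R]_(m, n)) : Prop :=
  forall i j, (fun t => A t i j) @ \oo --> B i j.

Definition enorm (n : nat) (x : 'rV[R]_n) : R := Num.sqrt (\sum_i x 0 i ^+ 2).

(* An oriented linear k-plane of R^n is represented by an orthonormal k-frame
   (the rows of F : 'M_(k,n)); two frames represent the same oriented plane
   iff they differ by an element of SO(k).  G_k(n) = V_k(n)/SO(k). *)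
Definition orthonormal_frame (k n : nat) (F : 'M[R]_(k, n)) : Prop :=
  F *m F^T = 1%:M.

Definition rotation (k : nat) (Q : 'M[R]_k) : Prop :=
  Q *m Q^T = 1%:M /\ \det Q = 1.

Definition same_oplane (k n : nat) (F G : 'M[R]_(k, n)) : Prop :=
  exists Q : 'M[R]_k, rotation Q /\ G = Q *m F.

(* Convergence in the oriented Grassmannian G_k(n) (quotient topology of the
   Stiefel manifold by SO(k)): some representatives converge. *)
Definition oplane_cvg (k n : nat) (Fs : nat -> 'M[R]_(k, n)) (F : 'M[R]_(k, n)) : Prop :=
  exists Gs : nat -> 'M[R]_(k, n),
    (forall t, same_oplane (Fs t) (Gs t)) /\ mx_cvg Gs F.

(* Foot point of the affine plane x + span(F): its point orthogonal to span(F). *)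
Definition foot (k n : nat) (x : 'rV[R]_n) (F : 'M[R]_(k, n)) : 'rV[R]_n :=
  x - x *m F^T *m F.

(* A fibration of R^n by oriented affine k-planes, given by the map
   fib : x |-> an orthonormal frame of pi(x); the fiber through x is the
   oriented affine plane x + span(fib x). *)
Definition fibration (k n : nat) (fib : 'rV[R]_n -> 'M[R]_(k, n)) : Prop :=
  (forall x, orthonormal_frame (fib x)) /\
  (* fibers are pairwise disjoint: if y is in the fiber through x, the
     fiber through y is the same oriented affine plane *)
  (forall x y, (y - x <= fib x)%MS -> same_oplane (fib x) (fib y)) /\
  (forall (x : 'rV[R]_n) (xs : nat -> 'rV[R]_n), mx_cvg xs x ->
      oplane_cvg (fun t => fib (xs t)) (fib x) /\
      mx_cvg (fun t => foot (xs t) (fib (xs t))) (foot x (fib x))).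

Definition skew_fibration (k n : nat) (fib : 'rV[R]_n -> 'M[R]_(k, n)) : Prop :=
  fibration fib /\
  (forall x y, ~ (y - x <= fib x)%MS ->
     forall v : 'rV[R]_n, (v <= fib x)%MS -> (v <= fib y)%MS -> v = 0).

Definition in_L (k n : nat) (fib : 'rV[R]_n -> 'M[R]_(k, n)) (l : 'rV[R]_n) : Prop :=
  enorm l = 1 /\ exists x, (l <= fib x)%MS.

End Defs.

(* Main.v *)
(* The distance g(z) from x0 to the fiber through z is continuous in z. If
   g(y_t) >= e > 0 along a subsequence, then, as g vanishes at the point
   x0 + |y_t| l of the fiber of x0, the segment from that point to y_t contains
   z_t with g(z_t) = e, and (z_t - x0)/|y_t| still tends to l. The points q_t
   nearest to x0 on the fibers through z_t subconverge to some q at distance e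
   from x0; the fiber through q contains the direction l, so by skewness it is
   the fiber of x0, whereas its distance to x0 is e. Hence g(y_t) -> 0, and
   continuity at x0 applies to the points nearest to x0 on the fibers of y_t. *)
Require Import Defs.
From HB Require Import structures.
From mathcomp Require Import all_boot all_order all_algebra.
From mathcomp Require Import all_classical all_reals all_analysis.
Import Order.TTheory GRing.Theory Num.Theory.
Import numFieldNormedType.Exports.
Local Open Scope classical_set_scope.
Local Open Scope ring_scope.

Set Implicit Arguments. Unset Strict Implicit. Unset Printing Implicit Defensive.

(** Asking only [m <= f m], not monotonicity, lets indices be picked by choice. *)
Lemma cvg_infty_ge (f : nat -> nat) : (forall m, (m <= f m)%N) -> f @ \oo --> \oo.
Proof.
move=> fge A [N _ NA]; exists N => // m /= Nm.
by apply: NA => /=; apply: leq_trans (fge m).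
Qed.

Lemma increasing_seq_ge (f : nat -> nat) : increasing_seq f -> forall m, (m <= f m)%N.
Proof.
move=> fi; elim=> // m IH; apply: (leq_ltn_trans IH).
by have := fi m.+1 m; rewrite leEnat ltnn ltnNge => ->.
Qed.

(** * Entrywise limits of matrices and compactness of bounded sequences *)

Section MxCvg.
Variable R : realType.

Lemma mx_cvg_cst m n (A : 'M[R]_(m, n)) : mx_cvg (fun=> A) A.
Proof. by move=> i j; exact: cvg_cst. Qed.

Lemma mx_cvgD m n (A B : nat -> 'M[R]_(m, n)) a b :
  mx_cvg A a -> mx_cvg B b -> mx_cvg (fun t => A t + B t) (a + b).
Proof.
move=> Aa Bb i j; rewrite mxE; under eq_fun do rewrite mxE.
exact: cvgD (Aa i j) (Bb i j).
Qed.

Lemma mx_cvgB m n (A B : nat -> 'M[R]_(m, n)) a b :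
  mx_cvg A a -> mx_cvg B b -> mx_cvg (fun t => A t - B t) (a - b).
Proof.
move=> Aa Bb i j; rewrite !mxE; under eq_fun do rewrite !mxE.
exact: cvgB (Aa i j) (Bb i j).
Qed.

Lemma mx_cvgZ m n (c : nat -> R) (A : nat -> 'M[R]_(m, n)) (c0 : R) a :
  c @ \oo --> c0 -> mx_cvg A a -> mx_cvg (fun t => c t *: A t) (c0 *: a).
Proof.
move=> cc Aa i j; rewrite mxE; under eq_fun do rewrite mxE.
exact: cvgM cc (Aa i j).
Qed.

Lemma mx_cvgM m n p (A : nat -> 'M[R]_(m, n)) (B : nat -> 'M[R]_(n, p)) a b :
  mx_cvg A a -> mx_cvg B b -> mx_cvg (fun t => A t *m B t) (a *m b).
Proof.
move=> Aa Bb i j; rewrite mxE; under eq_fun do rewrite mxE.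
apply: cvg_big => [|k _]; first exact: add_continuous.
exact: cvgM (Aa i k) (Bb k j).
Qed.

Lemma mx_cvg_tr m n (A : nat -> 'M[R]_(m, n)) a :
  mx_cvg A a -> mx_cvg (fun t => (A t)^T) a^T.
Proof. by move=> Aa i j; rewrite mxE; under eq_fun do rewrite mxE; exact: Aa. Qed.

Lemma mx_cvg_unique m n (A : nat -> 'M[R]_(m, n)) a b :
  mx_cvg A a -> mx_cvg A b -> a = b.
Proof. by move=> Aa Ab; apply/matrixP => i j; exact: cvg_unique (Aa i j) (Ab i j). Qed.

Lemma mx_cvg_comp m n (A : nat -> 'M[R]_(m, n)) a (f : nat -> nat) :
  (forall t, (t <= f t)%N) -> mx_cvg A a -> mx_cvg (fun t => A (f t)) a.
Proof. by move=> fge Aa i j; exact: cvg_comp (cvg_infty_ge fge) (Aa i j). Qed.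

Lemma cvg_enorm n (x : nat -> 'rV[R]_n) a :
  mx_cvg x a -> enorm (x t) @[t --> \oo] --> enorm a.
Proof.
move=> xa.
have sq_cvg : \sum_i x t 0 i ^+ 2 @[t --> \oo] --> \sum_i a 0 i ^+ 2.
  apply: cvg_big => [|k _]; first exact: add_continuous.
  exact: cvgM (xa 0 k) (xa 0 k).
exact: cvg_comp _ _ sq_cvg (@sqrt_continuous R _).
Qed.

Lemma le_enorm n (x : 'rV[R]_n) j : `|x 0 j| <= enorm x.
Proof.
rewrite -sqrtr_sqr ler_sqrt ?sumr_ge0// => [|i _]; last exact: sqr_ge0.
by rewrite (bigD1 j)//= lerDl sumr_ge0// => i _; exact: sqr_ge0.
Qed.

Lemma enorm0 n : enorm (0 : 'rV[R]_n) = 0.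
Proof. by rewrite /enorm big1 ?sqrtr0// => i _; rewrite mxE expr0n. Qed.

Lemma enorm_cvg0 n (x : nat -> 'rV[R]_n) :
  enorm (x t) @[t --> \oo] --> (0 : R) -> mx_cvg x 0.
Proof.
move=> x0 i j; rewrite (ord1 i) mxE.
apply: norm_cvg0; apply: squeeze_cvgr (cvg_cst 0) x0.
by near=> t; rewrite normr_ge0 le_enorm.
Unshelve. all: by end_near. Qed.

Lemma mx_cvg_scaled0 n (s : nat -> R) (x : nat -> 'rV[R]_n) :
  (forall t, `|s t| <= 1) -> mx_cvg x 0 -> mx_cvg (fun t => s t *: x t) 0.
Proof.
move=> s1 x0 i j; rewrite (ord1 i) mxE; under eq_fun do rewrite mxE.
apply: norm_cvg0.
have xn : `|x t 0 j| @[t --> \oo] --> (0 : R).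
  by have := x0 0 j; rewrite mxE => /cvg_norm; rewrite normr0.
apply: squeeze_cvgr (cvg_cst 0) xn.
by near=> t; rewrite normr_ge0 normrM ler_piMl.
Unshelve. all: by end_near. Qed.

(** Bolzano-Weierstrass is applied to one coordinate after another, each time refining the
    subsequence; coordinates already treated keep converging. *)
Lemma bounded_row_subseq n (x : nat -> 'rV[R]_n) (M : R) :
  (forall t, enorm (x t) <= M) ->
  exists2 f : nat -> nat, (forall t, (t <= f t)%N) &
    exists a, mx_cvg (fun t => x (f t)) a.
Proof.
move=> xM.
have [f fi fc] : exists2 f : nat -> nat, increasing_seq f &
    forall j, j \in enum 'I_n -> cvgn (fun t => x (f t) 0 j).
  elim: (enum 'I_n) => [|j s [f fi fc]]; first by exists id.
  have [|g gi gc] := @bolzano_weierstrass R (fun t => x (f t) 0 j).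
    exists M; split; first exact: num_real.
    move=> b Mb t _ /=; apply: le_trans (ltW Mb).
    by apply: le_trans (xM (f t)); exact: le_enorm.
  exists (f \o g) => [a b|i]; first exact: etrans (fi _ _) (gi _ _).
  rewrite inE => /orP[/eqP ->//|/fc fic].
  apply/cvg_ex; exists (lim (x (f t) 0 i @[t --> \oo])).
  by have := cvg_comp _ _ (cvg_infty_ge (increasing_seq_ge gi)) fic.
exists f; first exact: increasing_seq_ge.
exists (\row_j lim (x (f t) 0 j @[t --> \oo])) => i j.
by rewrite (ord1 i) mxE; apply: fc; rewrite mem_enum.
Qed.

End MxCvg.

Arguments mx_cvg_cst {R m n} A.

(** * Oriented planes and orthogonal projections *)

Section Planes.
Variables (R : realType) (k n : nat).
Implicit Types (F G : 'M[R]_(k, n)) (x v : 'rV[R]_n).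

(** For an orthonormal frame, this is the orthogonal projection onto the plane, acting on rows from
    the right. It is unchanged when the frame is rotated, so it has a true limit where frames
    converge only up to rotation. *)
Definition oproj F : 'M[R]_n := F^T *m F.

Lemma footE x F : foot x F = x - x *m oproj F.
Proof. by rewrite /foot mulmxA. Qed.

Lemma sub_oprojP F v : orthonormal_frame F -> (v <= F)%MS <-> v *m oproj F = v.
Proof.
move=> oF; split=> [/submxP[w ->]|<-]; last by rewrite mulmxA submxMl.
by rewrite -mulmxA (mulmxA F) (oF : F *m F^T = _) mul1mx.
Qed.

Lemma oproj_idem F : orthonormal_frame F -> oproj F *m oproj F = oproj F.
Proof. by move=> oF; rewrite /oproj -mulmxA (mulmxA F) (oF : F *m F^T = _) mul1mx. Qed.

Lemma same_oplane_oproj F G : same_oplane F G -> oproj G = oproj F.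
Proof.
move=> [Q [[/mulmx1C QQ _] ->]].
by rewrite /oproj trmx_mul -mulmxA (mulmxA Q^T) QQ mul1mx.
Qed.

Lemma same_oplane_trans F G H : same_oplane F G -> same_oplane G H -> same_oplane F H.
Proof.
move=> [Q [[Q1 Qd] ->]] [S [[S1 Sd] ->]]; exists (S *m Q); split; last by rewrite mulmxA.
split; last by rewrite det_mulmx Sd Qd mulr1.
by rewrite trmx_mul -mulmxA (mulmxA Q) Q1 mul1mx.
Qed.

Lemma oplane_cvg_oproj (Fs : nat -> 'M[R]_(k, n)) F :
  oplane_cvg Fs F -> mx_cvg (fun t => oproj (Fs t)) (oproj F).
Proof.
move=> [Gs [FG GF]].
rewrite (_ : (fun t => _) = (fun t => oproj (Gs t))); last first.
  by apply/funext => t; rewrite (same_oplane_oproj (FG t)).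
exact: mx_cvgM (mx_cvg_tr GF) GF.
Qed.

End Planes.

(** * Distance from a point to the fibers *)

Section Fibration.
Variables (R : realType) (k n : nat) (fib : 'rV[R]_n -> 'M[R]_(k, n)).
Hypothesis Hfib : fibration fib.
Implicit Types x z : 'rV[R]_n.

Let ofib x : orthonormal_frame (fib x). Proof. by case: Hfib. Qed.

(* The shortest vector from [x] to the fiber through [z]. *)
Definition offset x z := foot (z - x) (fib z).

Lemma same_fiber_oproj x z : (z - x <= fib x)%MS -> oproj (fib z) = oproj (fib x).
Proof. by case: Hfib => _ [H _] /H/same_oplane_oproj. Qed.

(** Going from [z] to [x + offset x z] subtracts the projection of [z - x], a vector parallel to the
    fiber through [z]. *)
Lemma offset_same_oplane x z : same_oplane (fib z) (fib (x + offset x z)).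
Proof.
case: Hfib => _ [H _]; apply: H.
rewrite /offset footE addrA [x + _]addrC subrK addrAC subrr add0r.
by rewrite -mulNmx mulmxA submxMl.
Qed.

Lemma offset_cvg x z (zs : nat -> 'rV[R]_n) :
  mx_cvg zs z -> mx_cvg (fun t => offset x (zs t)) (offset x z).
Proof.
move=> zsz; have [_ [_ H]] := Hfib; have [/oplane_cvg_oproj oc _] := H _ _ zsz.
rewrite /offset footE; rewrite (_ : (fun t => _) =
  (fun t => (zs t - x) - (zs t - x) *m oproj (fib (zs t)))); last first.
  by apply/funext => t; rewrite footE.
have c := mx_cvgB zsz (mx_cvg_cst x).
exact: mx_cvgB c (mx_cvgM c oc).
Qed.

Lemma offset_same_fiber x z : (z - x <= fib x)%MS -> offset x z = 0.
Proof.
move=> zx; rewrite /offset footE (same_fiber_oproj zx).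
by move/sub_oprojP: zx => -> //; rewrite subrr.
Qed.

Lemma offset_orthogonal x z : offset x z *m oproj (fib z) = 0.
Proof. by rewrite /offset footE mulmxBl -mulmxA oproj_idem// subrr. Qed.

End Fibration.

(* The fibers at distance [e] from [x0] form a compact family, none of which
   contains the direction [l]. *)
Lemma fibers_at_distance_not_asymptotic (R : realType) (k n : nat)
  (fib : 'rV[R]_n -> 'M[R]_(k, n)) (l x0 : 'rV[R]_n) (e : R)
  (a : nat -> R) (z : nat -> 'rV[R]_n) :
  skew_fibration fib -> l != 0 -> (l <= fib x0)%MS -> 0 < e ->
  (forall t, enorm (offset fib x0 (z t)) = e) ->
  a @ \oo --> (0 : R) -> ~ mx_cvg (fun t => a t *: (z t - x0)) l.
Proof.
move=> [Hfib skew] l0 lx0 e0 ze a0 azl.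
have ofib x : orthonormal_frame (fib x) by case: Hfib.
(* The offsets have constant norm [e], hence subconverge; the nearest points [q] then tend to
   [x0 + w]. *)
have [|f fge [w nw]] := @bounded_row_subseq R n (fun t => offset fib x0 (z t)) e.
  by move=> t; rewrite ze.
pose q t := x0 + offset fib x0 (z (f t)).
have qP t : oproj (fib (q t)) = oproj (fib (z (f t))).
  by rewrite (same_oplane_oproj (offset_same_oplane Hfib x0 (z (f t)))).
have qw : mx_cvg q (x0 + w) := mx_cvgD (mx_cvg_cst x0) nw.
have Pw : mx_cvg (fun t => oproj (fib (q t))) (oproj (fib (x0 + w))).
  by case: Hfib => _ [_ /(_ _ _ qw)[/oplane_cvg_oproj]].
have w_orth : w *m oproj (fib (x0 + w)) = 0.
  apply: mx_cvg_unique (mx_cvgM nw Pw) _.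
  rewrite (_ : (fun t => _) = fun=> 0); first exact: mx_cvg_cst.
  by apply/funext => t; rewrite qP offset_orthogonal.
(* Projecting [a *: (z - x0)] removes exactly [a] times the offset, which tends to 0 since [a] does
   and the offsets converge. The projected vectors thus tend both to [l *m oproj (fib (x0 + w))] and
   to [l]. *)
have lP : l *m oproj (fib (x0 + w)) = l.
  have d1 : mx_cvg (fun t => a (f t) *: (z (f t) - x0)) l := mx_cvg_comp fge azl.
  have af : a (f t) @[t --> \oo] --> (0 : R) := cvg_comp _ _ (cvg_infty_ge fge) a0.
  have d2 := mx_cvgB d1 (mx_cvgZ af nw).
  rewrite scale0r subr0 in d2.
  apply: mx_cvg_unique (mx_cvgM d1 Pw) _.
  rewrite (_ : (fun t => _) = (fun t => a (f t) *: (z (f t) - x0)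
      - a (f t) *: offset fib x0 (z (f t)))) //.
  apply/funext => t; rewrite qP -scalemxAl -scalerBr; congr (_ *: _).
  by rewrite /offset footE subKr.
have [wx0|/skew] := pselect (x0 + w - x0 <= fib x0)%MS; last first.
  move=> /(_ l lx0); rewrite (sub_oprojP _ (ofib _)) => /(_ lP) lE.
  by rewrite lE eqxx in l0.
(* Here [w] is both parallel and orthogonal to the fiber of [x0], against its norm being [e]. *)
have w0 : w = 0.
  rewrite -w_orth (same_fiber_oproj Hfib wx0); apply/esym/sub_oprojP => //.
  by rewrite addrC addKr in wx0.
have ew : enorm w = e.
  have := cvg_enorm nw; under eq_fun do rewrite ze.
  by move=> /cvg_unique; apply => //; exact: cvg_cst.
by rewrite w0 enorm0 in ew; rewrite -ew ltxx in e0.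
Qed.

(** Along the segment from [p] to [y] the distance from [x] to the fiber varies continuously, from 0
    at [p] to at least [e] at [y]. *)
Lemma offset_IVT (R : realType) (k n : nat)
  (fib : 'rV[R]_n -> 'M[R]_(k, n)) (x p y : 'rV[R]_n) (e : R) :
  fibration fib -> (p - x <= fib x)%MS -> 0 <= e <= enorm (offset fib x y) ->
  exists2 s : R, `|s| <= 1 & enorm (offset fib x (p + s *: (y - p))) = e.
Proof.
move=> Hfib px /andP[e0 ey].
pose h s := enorm (offset fib x (p + s *: (y - p))).
have hc : continuous h.
  move=> s; suff : h x @[x --> s] --> h s by [].
  (* [mx_cvg] concerns sequences, so continuity is tested on them. *)
  apply/(@cvg_nbhsP _ R^o) => u us; apply: cvg_enorm; apply: offset_cvg => //.
  by apply: mx_cvgD (mx_cvg_cst _) _; exact: mx_cvgZ us (mx_cvg_cst _).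
have h0 : h 0 = 0 by rewrite /h scale0r addr0 offset_same_fiber// enorm0.
have h1 : h 1 = enorm (offset fib x y) by rewrite /h scale1r addrC subrK.
have [||s] := @IVT R h 0 1 e ler01.
- exact: continuous_subspaceT.
- by rewrite h0 h1 ge_min e0 /= le_max ey orbT.
rewrite in_itv /= => /andP[s0 s1] hs; exists s => //.
by rewrite ger0_norm.
Qed.

Theorem theorem4p2 (R : realType) (k n : nat) (fib : 'rV[R]_n -> 'M[R]_(k, n))
  (Hfib : skew_fibration fib) (l : 'rV[R]_n) (hL : in_L fib l)
  (x0 : 'rV[R]_n) (hiota : (l <= fib x0)%MS)
  (y : nat -> 'rV[R]_n)
  (hy : (fun t => enorm (y t)) @ \oo --> +oo)
  (hdir : mx_cvg (fun t => (enorm (y t))^-1 *: y t) l) :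
  oplane_cvg (fun t => fib (y t)) (fib x0).
Proof.
have fibF := Hfib.1.
have l0 : l != 0.
  by apply/eqP => lE; have := hL.1; rewrite lE enorm0 => /eqP; rewrite eq_sym oner_eq0.
have ygt0 : \forall t \near \oo, 0 < enorm (y t) by move/cvgryPgt : hy => /(_ 0).
have yV0 : (enorm (y t))^-1 @[t --> \oo] --> (0 : R) by apply/gtr0_cvgV0.
have dist0 : enorm (offset fib x0 (y t)) @[t --> \oo] --> (0 : R).
  apply/cvgrPdist_lt => e e0; apply: contrapT => nfar.
  (* Positivity of the norm is built into the choice because [r t] gets inverted below. *)
  have /choice[f fP] (N : nat) : exists t, [/\ (N <= t)%N, 0 < enorm (y t)
      & e <= enorm (offset fib x0 (y t))].
    apply: contrapT => none; apply: nfar.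
    near=> t; rewrite ltNge; apply/negP; rewrite sub0r normrN ger0_norm ?sqrtr_ge0//.
    move=> et; apply: none; exists t; split => //; near: t => //.
    exact: nbhs_infty_ge.
  have fge t : (t <= f t)%N by case: (fP t).
  pose r t := enorm (y (f t)).
  have rV0 : (r t)^-1 @[t --> \oo] --> (0 : R) := cvg_comp _ _ (cvg_infty_ge fge) yV0.
  (* The segment starts on the fiber of [x0], at the scale [r t] of its other end, so that after
     division by [r t] both ends tend to [l]. *)
  have /choice[s sP] t : exists s, `|s| <= 1 /\ enorm (offset fib x0
      (x0 + r t *: l + s *: (y (f t) - (x0 + r t *: l)))) = e.
    case: (fP t) => _ _ et.
    have [||s] := @offset_IVT R k n fib x0 (x0 + r t *: l) (y (f t)) e fibF.
    - by rewrite addrC addKr scalemx_sub.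
    - by rewrite (ltW e0).
    by exists s.
  apply: (@fibers_at_distance_not_asymptotic R k n fib l x0 e (fun t => (r t)^-1) _
    Hfib l0 hiota e0 (fun t => (sP t).2) rV0).
  (* The bracket multiplied by [s t] tends to [l - 0 - l = 0], and [s t] is bounded. *)
  rewrite (_ : (fun t => _) = (fun t => l + s t *:
      ((r t)^-1 *: y (f t) - (r t)^-1 *: x0 - l))); last first.
    apply/funext => t; case: (fP t) => _ rt _.
    have rK : (r t)^-1 *: (r t *: l) = l by rewrite scalerA mulVf ?scale1r// gt_eqF.
    rewrite addrAC [x0 + _]addrC addrK scalerDr rK; congr (_ + _).
    by rewrite scalerA mulrC -scalerA opprD addrA 2!(scalerBr (r t)^-1) rK addrAC.
  rewrite -[l in X in mx_cvg _ X]addr0; apply: mx_cvgD; first exact: mx_cvg_cst.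
  apply: mx_cvg_scaled0 => [t|]; first exact: (sP t).1.
  have := mx_cvgB (mx_cvgB (mx_cvg_comp fge hdir) (mx_cvgZ rV0 (mx_cvg_cst x0)))
    (mx_cvg_cst l).
  by rewrite scale0r subr0 subrr.
have qx0 : mx_cvg (fun t => x0 + offset fib x0 (y t)) x0.
  by rewrite -[X in mx_cvg _ X]addr0; exact: mx_cvgD (mx_cvg_cst _) (enorm_cvg0 dist0).
have [_ [_ /(_ _ _ qx0)[[Gs [GsP Gs_cvg]] _]]] := fibF.
(* Representatives converging for the nearest points also serve [y t], whose fiber is the same with
   the same orientation. *)
exists Gs; split => // t; apply: same_oplane_trans (GsP t).
exact: offset_same_oplane.
Unshelve. all: by end_near. Qed.
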